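(* Let $\Gamma$ and $\Lambda$ be two finitely generated groups and fix finite generating systems $S_\Gamma$ of $\Gamma$ and $S_\Lambda$ of $\Lambda$. Assume that the Cayley graphs $(\Gamma,S_\Gamma)$ and $(\Lambda,S_\Lambda)$ are isometric. Let $\Gamma\curvearrowright^\alpha(X,\mu)$ and $\Lambda\curvearrowright^\beta(Y,\nu)$ be two p.m.p. essentially free actions that are isometric orbit equivalent (with respect to $S_\Gamma$ and $S_\Lambda$). If $\mathrm{Iso}(\Gamma)$ (equivalently $\mathrm{Iso}(\Lambda)$) is countable, then: (i) there exist finite index subgroups $\Gamma_0\leq\Gamma$ and $\Lambda_0\leq\Lambda$ which are isomorphic; (ii) there exist a $\Gamma_0$-invariant measurable subset $X_0\subseteq X$ of positive measure and a $\Lambda_0$-invariant measurable subset $Y_0\subseteq Y$ of positive measure such that the p.m.p. actions $\Gamma_0\curvearrowright(X_0,\mu_{X_0})$ and $\Lambda_0\curvearrowright(Y_0,\nu_{Y_0})$ are measurably isomorphic. If in addition every finite index subgroup of $\Gamma$ acts ergodically on $(X,\mu)$, then $\Gamma$ and $\Lambda$ are isomorphic and $\alpha$ and $\beta$ are measurably isomorphic.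
   Context: A finite generating system of a group is a finite symmetric generating set not containing the identity. A p.m.p. action $\Gamma\curvearrowright^\alpha(X,\mu)$ on a standard probability space is an action of $\Gamma$ by bimeasurable bijections $\alpha(\gamma)$ of $X$ preserving the probability measure $\mu$. It is essentially free if the set of points with trivial stabilizer has full measure, and ergodic if every invariant measurable set has measure $0$ or $1$. For $X_0\subseteq X$ of positive measure, $\mu_{X_0}$ is the normalized restriction of $\mu$ to $X_0$. P.m.p. actions of two groups $\Gamma_0$, $\Lambda_0$ on $(X_0,\mu_{X_0})$, $(Y_0,\nu_{Y_0})$ are measurably isomorphic if there are a group isomorphism $\theta:\Gamma_0\to\Lambda_0$ and a measure-preserving bimeasurable bijection $\Psi:X_0\to Y_0$ (up to null sets) such that, for every $\gamma\in\Gamma_0$, $\Psi(\gamma x)=\theta(\gamma)\Psi(x)$ for almost every $x$. Cayley graph: $(\Gamma,S_\Gamma)$ is the graph with vertex set $\Gamma$ and edges $\{\gamma,\gamma s\}$ for $\gamma\in\Gamma$, $s\in S_\Gamma$, endowed with the graph distance. Two Cayley graphs $(\Gamma,S_\Gamma)$ and $(\Lambda,S_\Lambda)$ are isometric if there is a bijection $\Gamma\to\Lambda$ that is an isometry for the graph distances. $\mathrm{Iso}(\Gamma)$ denotes the group of all bijective isometries of the Cayley graph $(\Gamma,S_\Gamma)$, and $\mathrm{Iso}(\Lambda)$ that of $(\Lambda,S_\Lambda)$. Isometric orbit equivalence: for a p.m.p. action $\alpha$ of $\Gamma$ on $(X,\mu)$, let $d_{\alpha(S_\Gamma)}(x,x')\in\mathbb{N}\cup\{+\infty\}$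 be the graph distance on the graph with vertex set $X$ and edge set $\{(x,x')\in X\times X : \exists s\in S_\Gamma,\ \alpha(s)x=x'\}$ (equal to $+\infty$ if $x,x'$ lie in different connected components). Two p.m.p. actions $\Gamma\curvearrowright^\alpha(X,\mu)$ and $\Lambda\curvearrowright^\beta(Y,\nu)$ are isometric orbit equivalent if there exist a bimeasurable bijection $\Phi:X\to Y$ with $\Phi_*\mu=\nu$ and a $\Gamma$-invariant measurable set $X_1\subseteq X$ with $\mu(X_1)=1$ such that $\Phi(X_1)$ is $\Lambda$-invariant and $d_{\beta(S_\Lambda)}(\Phi(x),\Phi(x'))=d_{\alpha(S_\Gamma)}(x,x')$ for all $x,x'\in X_1$. *)

(* Defs.v *)
From HB Require Import structures.
From mathcomp Require Import all_boot all_order all_algebra.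
From mathcomp Require Import all_classical all_reals all_analysis.

Set Implicit Arguments.
Unset Strict Implicit.
Unset Printing Implicit Defensive.

Import Order.TTheory GRing.Theory Num.Theory.
Import numFieldNormedType.Exports.

Local Open Scope classical_set_scope.

Section GraphDistance.
Variables (T : Type) (E : T -> T -> Prop).

Fixpoint walk (n : nat) (x y : T) : Prop :=
  if n is m.+1 then exists2 z, E x z & walk m z y else x = y.

(* [None] is the distance [+oo]. [E] is only used with symmetric relations. *)
Definition graph_dist (x y : T) : option nat :=
  if pselect (exists n, `[< walk n x y >]) is left exn
  then Some (ex_minn exn) else None.

End GraphDistance.

Section Groups.
Variables G : groupType.
Implicit Types (S H : set G).

Definition subgroup H := group_closed [in H].

Definition generating_system S :=
  [/\ finite_set S, ~ S 1%g, (forall s, S s -> S (s^-1)%g)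
    & forall H, subgroup H -> S `<=` H -> H = setT].

Definition finite_index H :=
  finite_set (range (fun g => [set (g * h)%g | h in H])).

Definition cayley_edge S (g h : G) := exists2 s, S s & h = (g * s)%g.

Definition cayley_dist S := graph_dist (cayley_edge S).

End Groups.

Definition cayley_isometry (G L : groupType) (S : set G) (T : set L)
    (f : G -> L) :=
  bijective f /\
  forall g h, cayley_dist T (f g) (f h) = cayley_dist S g h.

Definition cayley_isometric (G L : groupType) (S : set G) (T : set L) :=
  exists f : G -> L, cayley_isometry S T f.

Definition Iso (G : groupType) (S : set G) : set (G -> G) :=
  [set f | cayley_isometry S S f].

Definition group_iso_on (G L : groupType) (G0 : set G) (L0 : set L)
    (theta : G -> L) :=
  set_bij G0 L0 theta /\
  {in G0 &, {morph theta : g h / (g * h)%g >-> (g * h)%g}}.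

Definition subgroups_isomorphic (G L : groupType) (G0 : set G) (L0 : set L) :=
  exists theta : G -> L, group_iso_on G0 L0 theta.

(* The sigma-algebra of [X] is the Borel sigma-algebra of a complete separable
   metric on [X], i.e. that of a Polish space [P] transported by a bijection. *)
Definition standard_borel (R : realType) d (X : measurableType d) :=
  exists (P : metricType R) (f : X -> P),
    [/\ (forall F : set_system P, ProperFilter F -> cauchy F ->
           exists p : P, F --> p),
        (exists2 D : set P, countable D & dense D),
        bijective f
      & forall A : set X, measurable A <-> <<s open >> (f @` A)].

Definition bimeasurable_bij d d' (X : measurableType d)
    (Y : measurableType d') (f : X -> Y) :=
  measurable_fun setT f /\
  exists g : Y -> X, [/\ cancel f g, cancel g f & measurable_fun setT g].

Section Actions.
Variables (R : realType) (G : groupType).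
Variables (d : measure_display) (X : measurableType d) (mu : probability X R).
Implicit Types (alpha : G -> X -> X) (H : set G) (A : set X).

Definition pmp_action alpha :=
  [/\ (forall x, alpha 1%g x = x),
      (forall g h x, alpha (g * h)%g x = alpha g (alpha h x)),
      (forall g, bimeasurable_bij (alpha g))
    & forall g A, measurable A -> pushforward mu (alpha g) A = mu A].

Definition essentially_free alpha :=
  {ae mu, forall x, forall g, alpha g x = x -> g = 1%g}.

Definition invariant_set alpha H A := forall g, H g -> alpha g @` A = A.

Definition ergodic alpha H :=
  forall A, measurable A -> invariant_set alpha H A ->
    mu A = 0%E \/ mu A = 1%E.

Definition schreier_dist alpha (S : set G) :=
  graph_dist (fun x x' : X => exists2 s, S s & alpha s x = x').

Definition normalized_restr (X0 A : set X) : \bar R :=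
  (mu (A `&` X0) * ((fine (mu X0))^-1)%:E)%E.

End Actions.

Section TwoActions.
Variables (R : realType) (G L : groupType) (d d' : measure_display).
Variables (X : measurableType d) (mu : probability X R).
Variables (Y : measurableType d') (nu : probability Y R).
Implicit Types (alpha : G -> X -> X) (beta : L -> Y -> Y).

Definition isometric_orbit_equivalent alpha beta (S : set G) (T : set L) :=
  exists (Phi : X -> Y) (X1 : set X),
    [/\ bimeasurable_bij Phi,
        (forall B, measurable B -> pushforward mu Phi B = nu B),
        [/\ measurable X1, invariant_set alpha setT X1 & mu X1 = 1%E],
        invariant_set beta setT (Phi @` X1)
      & forall x x', X1 x -> X1 x' ->
          schreier_dist beta T (Phi x) (Phi x') = schreier_dist alpha S x x'].

(* [Psi] is only meaningful on a conull measurable subset [X'] of [X0], which it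
   maps bijectively onto a conull measurable subset [Y'] of [Y0]. *)
Definition mod0_isomorphism (X0 : set X) (Y0 : set Y) (Psi : X -> Y) :=
  exists (X' : set X) (Y' : set Y),
    [/\ [/\ measurable X', X' `<=` X0 & mu (X0 `\` X') = 0%E],
        [/\ measurable Y', Y' `<=` Y0 & nu (Y0 `\` Y') = 0%E],
        set_bij X' Y' Psi,
        measurable_fun X' Psi /\
          (forall A, measurable A -> A `<=` X' -> measurable (Psi @` A))
      & forall B, measurable B -> B `<=` Y' ->
          normalized_restr mu X0 (X' `&` Psi @^-1` B) =
          normalized_restr nu Y0 B].

Definition measurably_isomorphic alpha (G0 : set G) (X0 : set X)
    beta (L0 : set L) (Y0 : set Y) :=
  exists (theta : G -> L) (Psi : X -> Y),
    [/\ group_iso_on G0 L0 theta,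
        mod0_isomorphism X0 Y0 Psi
      & forall g, G0 g ->
          {ae mu, forall x, X0 x -> Psi (alpha g x) = beta (theta g) (Psi x)}].

End TwoActions.

(* Main.v *)
Require Import Defs.
From HB Require Import structures.
From mathcomp Require Import all_boot all_order all_algebra.
From mathcomp Require Import all_classical all_reals all_analysis.

Set Implicit Arguments.
Unset Strict Implicit.
Unset Printing Implicit Defensive.

Import Order.TTheory GRing.Theory Num.Theory.
Import numFieldNormedType.Exports.

Local Open Scope classical_set_scope.

(** Let [Phi] be the isometric orbit equivalence.  Almost every [x] has free
    orbits on both sides, and then [Phi (g x) = rho_x g (Phi x)] defines a
    bijection [rho_x : Gamma -> Lambda].  The edges of the orbit graph join
    [g x] to [s g x], those of the Cayley graph join [g] to [g s]; so it is
    [g |-> (rho_x g^-1)^-1] that is an isometry of Cayley graphs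
    ([orbit_isometry]).

    If [Iso Gamma] is countable, so is the set of isometries from [Gamma] to
    [Lambda]: composing with the inverse of one of them embeds it into
    [Iso Gamma].  The measurable map [x |-> rho_x] thus takes countably many
    values and is constant, equal to some [rho], on a set [A] of positive
    measure ([constant_cocycle_piece]).

    The cocycle identity [rho_x (g h) = rho_(h x) g * rho_x h] shows that, for
    [x] in [A], the point [h x] lies in [A] exactly when
    [rho (g h) = rho g * rho h] for all [g].  These [h] form a subgroup
    [right_mult rho] of [Gamma], on which [rho] is a homomorphism.  The subgroup
    leaves [A] invariant, and its left cosets correspond to pairwise disjoint
    translates of [A], all of measure [mu A]; since [mu] is finite, its index
    is finite ([return_group_finite_index]), and so is that of its image,
    because [rho] maps left cosets to left cosets.  [Phi] conjugates the two
    restricted actions by construction.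

    If finite index subgroups act ergodically, [A] is conull.  Every translate
    of [A] then meets [A], hence [right_mult rho] is [Gamma]: the bijection
    [rho] is an isomorphism of groups and [Phi] one of actions. *)

(** * Walks and graph distances *)

Lemma graph_dist_fin (T : Type) (E : T -> T -> Prop) x y :
  graph_dist E x y <> None <-> exists n, walk E n x y.
Proof.
rewrite /graph_dist; case: pselect => [e|nw]; split => //.
- by move=> _; have [n /asboolP] := e; exists n.
- by case=> n w; case: nw; exists n; apply/asboolP.
Qed.

Lemma eq_graph_dist (T T' : Type) (E : T -> T -> Prop) (E' : T' -> T' -> Prop)
    x y x' y' :
  (forall n, walk E n x y <-> walk E' n x' y') ->
  graph_dist E x y = graph_dist E' x' y'.
Proof.
move=> eqw.
pose least (P : pred nat) :=
  if pselect (exists n, P n) is left exn then Some (ex_minn exn) else None.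
apply: (congr1 least).
by apply/funext => n; exact: asbool_equiv_eq.
Qed.

Lemma walk_trans (T : Type) (E : T -> T -> Prop) m n x y z :
  walk E m x y -> walk E n y z -> walk E (m + n) x z.
Proof.
elim: m x => [x ->//|m IHm x] /= [u xu uy] yz.
by exists u => //; exact: IHm.
Qed.

(** As [o] maps the edges at [a] onto the edges at [o a], a walk from [o a] can
    be lifted one edge at a time. *)
Lemma walk_lift (T T' : Type) (E : T -> T -> Prop) (E' : T' -> T' -> Prop)
    (o : T -> T') :
  (forall a z, E' (o a) z <-> exists2 b, E a b & o b = z) ->
  forall n a z, walk E' n (o a) z <-> exists2 b, walk E n a b & o b = z.
Proof.
move=> oE; elim=> [|n IHn] a z /=.
  by split=> [<-|[b -> <-]//]; exists a.
split=> [[u /oE[b ab <-] /IHn[c bc <-]]|[c [b ab bc] <-]].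
  by exists c => //; exists b.
exists (o b); first by apply/oE; exists b.
by apply/IHn; exists c.
Qed.

Lemma graph_dist_lift (T T' : Type) (E : T -> T -> Prop)
    (E' : T' -> T' -> Prop) (o : T -> T') :
  (forall a z, E' (o a) z <-> exists2 b, E a b & o b = z) -> injective o ->
  forall a b, graph_dist E' (o a) (o b) = graph_dist E a b.
Proof.
move=> oE oI a b; apply: eq_graph_dist => n; rewrite (walk_lift oE).
by split=> [[c ac /oI <-]|ab] //; exists b.
Qed.

(** * Cayley graphs *)

Lemma cayley_connected (G : groupType) (S : set G) :
  generating_system S -> forall g h, exists n, walk (cayley_edge S) n g h.
Proof.
case=> _ _ SV Sgen.
pose conn g h := exists n, walk (cayley_edge S) n g h.
have connT g h k : conn g h -> conn h k -> conn g k.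
  by move=> [m gh] [n hk]; exists (m + n)%N; exact: walk_trans hk.
(* Both directions are needed in H: v^-1 walks back along the path of v. *)
pose H : set G := [set h | forall g, conn g (g * h)%g /\ conn (g * h)%g g].
have HT : H = setT.
  apply: Sgen.
    split; first by rewrite inE => g; rewrite mulg1; split; exists 0%N.
    move=> u v; rewrite !inE => Hu Hv g; rewrite mulgA.
    have [uv vu] := Hv (g * u * v^-1)%g; rewrite mulgVK in uv vu.
    by split; [exact: connT (Hu g).1 vu|exact: connT uv (Hu g).2].
  move=> s Ss g; split; exists 1%N => /=.
    by exists (g * s)%g => //; exists s.
  by exists g => //; exists s^-1%g; [exact: SV|rewrite mulgK].
move=> g h; have : H (g^-1 * h)%g by rewrite HT.
by move=> /(_ g)[+ _]; rewrite mulVKg.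
Qed.

(** Cayley edges multiply on the right, hence commute with multiplication on the
    left. *)
Lemma translation_Iso (G : groupType) (S : set G) (g : G) :
  Iso S (fun h => g * h)%g.
Proof.
split; first by exists (fun h => g^-1 * h)%g => h; rewrite ?mulKg ?mulVKg.
apply: graph_dist_lift => [a z|]; last exact: mulgI.
split=> [[s Ss ->]|[_ [s Ss ->] <-]].
  by exists (a * s)%g; [exists s|rewrite mulgA].
by exists s; rewrite ?mulgA.
Qed.

(** Left translations embed the group into the isometries of its Cayley
    graph. *)
Lemma Iso_countable_group (G : groupType) (S : set G) :
  countable (Iso S) -> countable [set: G].
Proof.
apply: sub_countable.
have tI : {in [set: G] &, injective (fun g h : G => g * h)%g}.
  by move=> g h _ _ /(congr1 (@^~ 1%g)); rewrite !mulg1.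
rewrite -(card_le_eql (inj_card_eq tI)); apply: subset_card_le.
by move=> _ [g _ <-]; exact: translation_Iso.
Qed.

Lemma cayley_isometryV (G L : groupType) (S : set G) (T : set L) f f' :
  cancel f f' -> cancel f' f -> cayley_isometry S T f ->
  cayley_isometry T S f'.
Proof.
move=> fK f'K [_ fE]; split; first by exists f.
by move=> g h; rewrite -fE !f'K.
Qed.

Lemma cayley_isometry_comp (G L K : groupType) (S : set G) (T : set L)
    (U : set K) f f' :
  cayley_isometry S T f -> cayley_isometry T U f' ->
  cayley_isometry S U (f' \o f).
Proof.
move=> [fB fE] [f'B f'E]; split; first exact: bij_comp.
by move=> g h; rewrite /= f'E fE.
Qed.

Lemma cayley_isometric_sym (G L : groupType) (S : set G) (T : set L) :
  cayley_isometric S T -> cayley_isometric T S.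
Proof.
move=> [f [[f' fK f'K] fE]]; exists f'.
by apply: (cayley_isometryV fK) => //; split => //; exists f'.
Qed.

(** Once an isometry is chosen, composition with its inverse embeds all the
    others into [Iso S]. *)
Lemma countable_isometries (G L : groupType) (S : set G) (T : set L) :
  countable (Iso S) -> countable [set f : G -> L | cayley_isometry S T f].
Proof.
move=> cI; set J := [set f | _].
have [[f Jf]|J0] := pselect (J !=set0); last first.
  suff -> : J = set0 by exact: countable0.
  by rewrite -subset0 => f Jf; apply: J0; exists f.
have [[f' fK f'K] _] := Jf.
have comp_inj : {in J &, injective (fun u : G -> L => f' \o u)}.
  move=> u v _ _ uv; apply/funext => g; apply: (can_inj f'K).
  exact: (congr1 (@^~ g) uv).
apply: sub_countable cI; rewrite -(card_le_eql (inj_card_eq comp_inj)).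
apply: subset_card_le => _ [u Ju <-]; apply: cayley_isometry_comp Ju _.
exact: cayley_isometryV fK f'K Jf.
Qed.

Lemma countable_Iso_isometric (G L : groupType) (S : set G) (T : set L) :
  cayley_isometric S T -> countable (Iso S) -> countable (Iso T).
Proof.
move=> [f Jf] /(@countable_isometries G L S T).
have [[f' fK f'K] _] := Jf.
have comp_inj : {in Iso T &, injective (fun u : L -> L => u \o f)}.
  move=> u v _ _ uv; apply/funext => l.
  by have := congr1 (@^~ (f' l)) uv; rewrite /= f'K.
apply: sub_countable; rewrite -(card_le_eql (inj_card_eq comp_inj)).
apply: subset_card_le => _ [u Ju <-].
exact: cayley_isometry_comp Jf Ju.
Qed.

(** * Bijections of groups that are multiplicative on a subgroup *)

(** For a map [rho] that is the value of an orbit cocycle at some point, these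
    are the elements whose action leaves that value unchanged. *)
Definition right_mult (G L : groupType) (rho : G -> L) : set G :=
  [set h | forall g, rho (g * h)%g = (rho g * rho h)%g].

Section RightMultiplicative.
Context (G L : groupType) (rho : G -> L).
Hypothesis rho1 : rho 1%g = 1%g.
Local Notation H := (right_mult rho).

Lemma right_multV h : H h -> rho h^-1%g = (rho h)^-1%g.
Proof.
by move=> Hh; apply: (mulIg (rho h)); rewrite -Hh !mulVg.
Qed.

Lemma right_mult_inv h : H h -> H h^-1%g.
Proof.
move=> Hh g; rewrite (right_multV Hh); apply: (mulIg (rho h)).
by rewrite -Hh !mulgVK.
Qed.

Lemma right_mult_mul h k : H h -> H k -> H (h * k)%g.
Proof. by move=> Hh Hk g; rewrite mulgA !Hk Hh mulgA. Qed.

Lemma right_mult_subgroup : subgroup H.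
Proof.
split; first by rewrite inE => g; rewrite rho1 !mulg1.
by move=> h k; rewrite !inE => Hh /right_mult_inv; exact: right_mult_mul.
Qed.

Lemma image_right_mult_subgroup : subgroup (rho @` H).
Proof.
split; first by rewrite inE; exists 1%g => // g; rewrite rho1 !mulg1.
move=> _ _ /set_mem[h Hh <-] /set_mem[k Hk <-]; rewrite inE.
have Hk' := right_mult_inv Hk.
exists (h * k^-1)%g; first exact: right_mult_mul.
by rewrite Hk' right_multV.
Qed.

(** [rho] maps the left coset of [H] at [g] onto the left coset of [rho @` H] at
    [rho g]. *)
Lemma image_right_mult_finite_index :
  bijective rho -> finite_index H -> finite_index (rho @` H).
Proof.
move=> [rho' rhoK rho'K] fH.
apply: sub_finite_set (finite_image (fun C => rho @` C) fH) => _ [l _ <-].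
exists [set (rho' l * h)%g | h in H]; first by exists (rho' l).
rewrite !image_comp; apply: eq_imagel => h Hh /=.
by rewrite Hh rho'K.
Qed.

Lemma right_mult_group_iso_on :
  bijective rho -> group_iso_on H (rho @` H) rho.
Proof.
move=> rhoB; split; first by apply: inj_bij => g h _ _; exact: bij_inj.
by move=> g h _; rewrite inE => Hh; exact: Hh.
Qed.

End RightMultiplicative.

(** * Countable families of measurable sets *)

(** Turns unions over a countable index set into unions of sequences.  The
    option type makes room for an empty or finite [D]. *)
Lemma bigcup_countable_seq (I : Type) (D : set I) : countable D ->
  exists2 s : nat -> option I, (forall n i, s n = Some i -> D i) &
    forall (T : Type) (F : I -> set T),
      \bigcup_(i in D) F i = \bigcup_n oapp F set0 (s n).
Proof.
move=> /countable_injP[e eI].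
pose s n := if pselect (exists2 i, D i & e i = n) is left ex
            then Some (projT1 (cid2 ex)) else None.
have sD n i : s n = Some i -> D i.
  rewrite /s; case: pselect => // ex [<-].
  by case: cid2.
exists s => // T F; apply/seteqP; split=> [x [i Di Fix]|x [n _]].
  exists (e i) => //; rewrite /s; case: pselect => [ex|]; last first.
    by case; exists i.
  case: cid2 => j Dj ej /=.
  by rewrite (eI j i) ?inE.
by case sn: (s n) => [i|] //= Fix; exists i => //; exact: sD sn.
Qed.

Lemma countable_bigcup_measurable d (X : measurableType d) (I : Type)
    (D : set I) (F : I -> set X) : countable D ->
  (forall i, D i -> measurable (F i)) -> measurable (\bigcup_(i in D) F i).
Proof.
move=> /bigcup_countable_seq[s sD ->] mF; apply: bigcupT_measurable => n.
by case sn: (s n) => [i|] //=; apply: mF; exact: sD sn.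
Qed.

Lemma countable_bigcap_measurable d (X : measurableType d) (I : Type)
    (D : set I) (F : I -> set X) : countable D ->
  (forall i, D i -> measurable (F i)) -> measurable (\bigcap_(i in D) F i).
Proof.
move=> cD mF; rewrite -[X in measurable X]setCK setC_bigcap.
apply: measurableC; apply: countable_bigcup_measurable => // i Di.
exact/measurableC/mF.
Qed.

Lemma countable_bigcup_negligible d (X : measurableType d) (R : realType)
    (mu : {measure set X -> \bar R}%R) (I : Type) (D : set I) (F : I -> set X) :
  countable D -> (forall i, D i -> mu.-negligible (F i)) ->
  mu.-negligible (\bigcup_(i in D) F i).
Proof.
move=> /bigcup_countable_seq[s sD ->] nF; apply: negligible_bigcup => n.
case sn: (s n) => [i|] /=; first by apply: nF; exact: sD sn.
exact: negligible_set0.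
Qed.

(** [n] disjoint sets of measure [c] force [n * c <= 1]. *)
Lemma trivIset_finite d (X : measurableType d) (R : realType)
    (mu : probability X R) (I : Type) (D : set I) (F : I -> set X)
    (c : \bar R) :
  (0 < c)%E -> trivIset D F ->
  (forall i, D i -> measurable (F i) /\ mu (F i) = c) -> finite_set D.
Proof.
elim/Ppointed: I => I in D F *.
  by move=> *; rewrite (_ : D = set0) ?emptyE//; exact: finite_set0.
move=> c0 tF mF; apply: contrapT => /infiniteP/pcard_leP[f].
pose G n := F (f n).
have Df n : D (f n) by exact: funS.
have mG n : measurable (G n) by exact: (mF _ (Df n)).1.
have tG : trivIset setT G.
  move=> i j _ _ ij; apply: (@inj _ _ _ f); rewrite ?inE//.
  exact: tF ij.
have le1 n : (n%:R%:E * c <= 1)%E.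
  have -> : (n%:R%:E * c)%E = mu (\big[setU/set0]_(i < n) G i).
    rewrite measure_bigsetU//.
    rewrite (eq_bigr (fun=> c)) => [|i _]; last exact: (mF _ (Df i)).2.
    by rewrite sumr_const card_ord mule_natl.
  by apply: probability_le1; exact: bigsetU_measurable.
case: c c0 le1 {mF} => [r| |//].
  rewrite lte_fin => r0 /(_ (Num.bound r^-1)); rewrite -EFinM lee_fin leNgt.
  by rewrite -ltr_pdivrMr// div1r archi_boundP// invr_ge0 ltW.
by move=> _ /(_ 1%N); rewrite mul1e leye_eq.
Qed.

(** * The diagonal of a standard Borel space *)

(** A separable metric space has countably many open sets separating its
    points, here small balls around the points of a dense set; two functions
    differ at [x] exactly when one of these separates their values. *)
Lemma measurable_equalizer (R : realType) d d' (X : measurableType d)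
    (Y : measurableType d') (u v : X -> Y) :
  standard_borel R Y -> measurable_fun setT u -> measurable_fun setT v ->
  measurable [set x | u x = v x].
Proof.
move=> [P [h [_ [D cD dD] hB mY]]] mu mv.
have [h' hK h'K] := hB.
pose V (p : P) (n : nat) : set Y := h @^-1` (ball p n.+1%:R^-1)°.
have mV p n : measurable (V p n).
  apply/mY; rewrite /V image_preimage; last first.
    by rewrite -subTset => q _; exists (h' q).
  by apply: sub_sigma_algebra; exact: open_interior.
have sepV y z : y <> z -> exists p n, [/\ D p, V p n y & ~ V p n z].
  move=> yz.
  have dyz : (0 < mdist (h y) (h z))%R.
    by rewrite mdist_gt0; apply/eqP => /(bij_inj hB).
  have [n nlt] : exists n, (n.+1%:R^-1 + n.+1%:R^-1 < mdist (h y) (h z))%R.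
    have d2 : (0 < mdist (h y) (h z) / 2)%R by rewrite divr_gt0.
    have [n _ /(_ n (leqnn n)) nd] := near_infty_natSinv_lt (PosNum d2).
    exists n; rewrite [ltRHS]splitr.
    by apply: ltrD; exact: nd.
  have e0 : (0 < n.+1%:R^-1 :> R)%R by rewrite invr_gt0.
  have e20 : (0 < n.+1%:R^-1 / 2 :> R)%R by rewrite divr_gt0.
  (* Half the radius, so that a whole neighbourhood of h y lies in the ball of
     full radius around p. *)
  have [p [py Dp]] : (ball (h y) (n.+1%:R^-1 / 2))° `&` D !=set0.
    apply: dD; last exact: open_interior.
    by exists (h y); exact: nbhsx_ballx.
  exists p, n; split => //.
    rewrite /V /=; apply: filterS (nbhsx_ballx (h y) _ e20) => q yq.
    rewrite [X in ball _ X _]splitr; apply: ball_triangle yq.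
    by apply: ball_sym; exact: interior_subset py.
  have yp : ball (h y) n.+1%:R^-1 p.
    apply: le_ball (interior_subset py).
    by rewrite ler_pdivrMr// ler_peMr ?ler1n// ltW.
  move=> /interior_subset /(ball_triangle yp).
  by rewrite ballEmdist /= ltNge (ltW nlt).
rewrite -[X in measurable X]setCK; apply: measurableC.
suff -> : ~` [set x | u x = v x] =
    \bigcup_(p in D) \bigcup_n (u @^-1` V p n `&` v @^-1` (~` V p n)).
  apply: countable_bigcup_measurable => // p _.
  apply: bigcupT_measurable => n; apply: measurableI.
    by rewrite -[X in measurable X]setTI; exact: mu.
  by rewrite -[X in measurable X]setTI; apply: mv => //; exact: measurableC.
apply/seteqP; split=> [x /= /sepV[p [n [Dp Vu Vv]]]|x [p _ [n _ [Vu Vv]]]] /=.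
  by exists p => //; exists n.
by move=> uv; apply: Vv; rewrite -uv.
Qed.

(** * Probability-preserving actions *)

Lemma measurable_fun_preimage d d' (X : measurableType d)
    (Y : measurableType d') (f : X -> Y) (B : set Y) :
  measurable_fun setT f -> measurable B -> measurable (f @^-1` B).
Proof. by move=> mf mB; rewrite -[X in measurable X]setTI; exact: mf. Qed.

Lemma measurable_image_bij d d' (X : measurableType d)
    (Y : measurableType d') (f : X -> Y) (A : set X) :
  bimeasurable_bij f -> measurable A -> measurable (f @` A).
Proof.
move=> [_ [g [fK gK mg]]] mA; rewrite (_ : f @` A = g @^-1` A).
  exact: measurable_fun_preimage.
apply/seteqP; split=> [_ [x Ax <-]|y Agy] /=; first by rewrite fK.
by exists (g y).
Qed.

Lemma measure_image_bij d d' (X : measurableType d) (Y : measurableType d')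
    (R : realType) (mu : probability X R) (nu : probability Y R)
    (f : X -> Y) (A : set X) :
  bimeasurable_bij f ->
  (forall B, measurable B -> pushforward mu f B = nu B) ->
  measurable A -> nu (f @` A) = mu A.
Proof.
move=> fB fmu mA; rewrite -fmu; last exact: measurable_image_bij.
have [_ [g [fK _ _]]] := fB.
rewrite /pushforward; congr (mu _).
apply/seteqP; split=> [x [z Az /(can_inj fK) <-]//|x Ax].
by exists x.
Qed.

Section Action.
Context (R : realType) (G : groupType) (d : measure_display).
Context (X : measurableType d) (mu : probability X R) (alpha : G -> X -> X).
Hypothesis halpha : pmp_action mu alpha.

Lemma actK g : cancel (alpha g) (alpha g^-1%g).
Proof. by case: halpha => a1 aM _ _ x; rewrite -aM mulVg a1. Qed.

Lemma actKV g : cancel (alpha g^-1%g) (alpha g).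
Proof. by case: halpha => a1 aM _ _ x; rewrite -aM mulgV a1. Qed.

Lemma free_orbit_inj x :
  (forall g, alpha g x = x -> g = 1%g) -> injective (alpha^~ x).
Proof.
case: halpha => a1 aM _ _ freex g h /= gh.
have gh1 : (h^-1 * g)%g = 1%g by apply: freex; rewrite aM gh actK.
by rewrite -[g](mulVKg h) gh1 mulg1.
Qed.

Lemma invariant_setP (H : set G) (A : set X) : subgroup H ->
  (forall g x, H g -> A x -> A (alpha g x)) -> invariant_set alpha H A.
Proof.
move=> sH HA g Hg; apply/seteqP; split=> [_ [x Ax <-]|x Ax]; first exact: HA.
exists (alpha g^-1%g x); last by rewrite actKV.
apply: HA => //; apply/set_mem.
by apply: (group_closedV sH); rewrite inE.
Qed.

(** Away from the countably many translates of a null set, a property that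
    holds almost everywhere holds along whole orbits. *)
Lemma ae_invariant_set (P : X -> Prop) : countable [set: G] ->
  {ae mu, forall x, P x} ->
  exists W : set X, [/\ measurable W, mu W = 1%E, W `<=` P &
    forall g x, W x -> W (alpha g x)].
Proof.
move=> cG [N [mN N0 PN]].
have [a1 aM aB amu] := halpha.
have mNg g : measurable (alpha g @^-1` N).
  by apply: measurable_fun_preimage => //; have [] := aB g.
have mU : measurable (\bigcup_g alpha g @^-1` N).
  exact: countable_bigcup_measurable.
exists (~` \bigcup_g alpha g @^-1` N); split.
- exact: measurableC.
- rewrite probability_setC//.
  suff -> : mu (\bigcup_g alpha g @^-1` N) = 0%E by rewrite sube0.
  apply: measure_negligible => //.
  apply: countable_bigcup_negligible => // g _.
  by apply/negligibleP => //; rewrite -N0 -[RHS](amu g).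
- move=> x NWx; apply: contrapT => nPx; apply: NWx.
  by exists 1%g => //=; rewrite a1; exact: PN.
- move=> g x NWx [h _ /= Nh]; apply: NWx; exists (h * g)%g => //=.
  by rewrite aM.
Qed.

(** Translates of [A] by distinct cosets of [H] are disjoint and have the same
    positive measure, so there is room for finitely many of them only. *)
Lemma return_group_finite_index (H : set G) (A : set X) :
  subgroup H -> measurable A -> (0 < mu A)%E ->
  (forall g x, A x -> A (alpha g x) <-> H g) -> finite_index H.
Proof.
move=> sH mA A0 HA; have [a1 aM aB amu] := halpha.
have HM g h : H g -> H h -> H (g * h)%g.
  by move=> Hg Hh; apply/set_mem/(group_closedM sH); rewrite inE.
pose coset g := [set (g * h)%g | h in H].
pose F (C : set G) := [set alpha g x | g in C & x in A].
have FE g : F (coset g) = alpha g @` A.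
  apply/seteqP; split=> [_ [_ [h Hh <-] [x Ax <-]]|_ [x Ax <-]].
    by exists (alpha h x); [apply/HA|rewrite aM].
  exists g; last by exists x.
  exists 1%g; last by rewrite mulg1.
  by apply/set_mem; exact: sH.1.
apply: (trivIset_finite (F := F) A0) => [|_ [g _ <-]]; last first.
  rewrite FE; split; first exact: measurable_image_bij.
  by apply: measure_image_bij => //; exact: amu.
have sub_coset g h x : A x -> A (alpha (h^-1 * g)%g x) ->
    coset g `<=` coset h.
  move=> Ax /HA - /(_ Ax) Hhg _ [k Hk <-].
  by exists (h^-1 * g * k)%g; [exact: HM|rewrite !mulgA mulgV mul1g].
apply/trivIsetP => _ _ [g _ <-] [h _ <-] gh; rewrite -subset0.
move=> y [] /=; rewrite -/(coset g) -/(coset h) !FE => -[x Ax <-] [z Az zx].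
apply: (negP gh); apply/eqP/seteqP; split.
  by apply: (@sub_coset _ _ x) => //; rewrite aM -zx actK.
by apply: (@sub_coset _ _ z) => //; rewrite aM zx actK.
Qed.

End Action.

(** * Comparing orbits *)

(** The inverses turn the left multiplications of the action into the right
    multiplications of the Cayley graph. *)
Lemma orbit_dist (R : realType) (G : groupType) (S : set G)
    (d : measure_display) (X : measurableType d) (mu : probability X R)
    (alpha : G -> X -> X) (x : X) :
  pmp_action mu alpha -> generating_system S ->
  (forall g, alpha g x = x -> g = 1%g) -> forall g h,
  schreier_dist alpha S (alpha g^-1%g x) (alpha h^-1%g x) = cayley_dist S g h.
Proof.
move=> halpha [_ _ SV _] freex; have [_ aM _ _] := halpha.
apply: (graph_dist_lift (o := fun g => alpha g^-1%g x)) => [g z|g h gh].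
  split=> [[s Ss <-]|[_ [s Ss ->] <-]].
    exists (g * s^-1)%g; first by exists s^-1%g => //; exact: SV.
    by rewrite invgM invgK aM.
  by exists s^-1%g; [exact: SV|rewrite invgM aM].
exact: invg_inj (free_orbit_inj halpha freex gh).
Qed.

Lemma finite_dist_orbit (R : realType) (G : groupType) (S : set G)
    (d : measure_display) (X : measurableType d) (mu : probability X R)
    (alpha : G -> X -> X) (x y : X) :
  pmp_action mu alpha -> schreier_dist alpha S x y <> None ->
  exists g, y = alpha g x.
Proof.
move=> [a1 aM _ _] /graph_dist_fin[n].
elim: n x => [|n IHn] x /=; first by move=> <-; exists 1%g; rewrite a1.
by case=> _ [s _ <-] /IHn[g ->]; exists (g * s)%g; rewrite aM.
Qed.

(** * The orbit cocycle of an isometric orbit equivalence *)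

(** Cayley graphs have their generators on the right, actions on the left; this
    involution turns isometries of Cayley graphs into values of the orbit
    cocycle and back. *)
Definition inv_conj (G L : groupType) (f : G -> L) (g : G) : L :=
  (f g^-1%g)^-1%g.

Lemma inv_conj_bij (G L : groupType) (f : G -> L) :
  bijective f -> bijective (inv_conj f).
Proof.
move=> [f' fK f'K]; exists (fun l => (f' l^-1%g)^-1%g) => z.
  by rewrite /inv_conj invgK fK invgK.
by rewrite /inv_conj invgK f'K invgK.
Qed.

Section OrbitEquivalence.
Context (R : realType) (Gamma Lambda : groupType).
Context (S : set Gamma) (T : set Lambda).
Context (dX dY : measure_display).
Context (X : measurableType dX) (mu : probability X R).
Context (Y : measurableType dY) (nu : probability Y R).
Context (alpha : Gamma -> X -> X) (beta : Lambda -> Y -> Y).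
Context (Phi : X -> Y) (X1 : set X).
Hypothesis hS : generating_system S.
Hypothesis hT : generating_system T.
Hypothesis halpha : pmp_action mu alpha.
Hypothesis hbeta : pmp_action nu beta.
Hypothesis hPhi : bimeasurable_bij Phi.
Hypothesis hPhimu : forall B, measurable B -> pushforward mu Phi B = nu B.
Hypothesis hX1 : invariant_set alpha setT X1.
Hypothesis hPhiX1 : invariant_set beta setT (Phi @` X1).
Hypothesis hdist : forall x x', X1 x -> X1 x' ->
  schreier_dist beta T (Phi x) (Phi x') = schreier_dist alpha S x x'.

(** [Phi] maps the orbit of [x], a copy of the Cayley graph of [Gamma],
    isometrically onto the orbit of [Phi x], a copy of that of [Lambda]: the
    finiteness of distances says which points lie in these orbits. *)
Lemma orbit_isometry (x : X) : X1 x ->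
  (forall g, alpha g x = x -> g = 1%g) ->
  (forall l, beta l (Phi x) = Phi x -> l = 1%g) ->
  exists2 f, cayley_isometry S T f &
    forall g, Phi (alpha g x) = beta (inv_conj f g) (Phi x).
Proof.
move=> X1x freex freey.
have [Psi [PhiK _ _]] := hPhi.2.
have X1a g : X1 (alpha g x) by rewrite -(hX1 (I : setT g)); exists x.
have [a1 aM _ _] := halpha; have [b1 bM _ _] := hbeta.
have /choice[f fE] : forall g, exists l,
    Phi (alpha g^-1%g x) = beta l^-1%g (Phi x).
  move=> g; have : schreier_dist beta T (Phi x) (Phi (alpha g^-1%g x)) <> None.
    rewrite hdist//; have := orbit_dist halpha hS freex 1%g g.
    rewrite invg1 a1 => ->; apply/graph_dist_fin.
    exact: cayley_connected.
  by move=> /(finite_dist_orbit hbeta)[l ->]; exists l^-1%g; rewrite invgK.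
have fdist g h : cayley_dist T (f g) (f h) = cayley_dist S g h.
  by rewrite -(orbit_dist hbeta hT freey) -!fE hdist// (orbit_dist halpha).
have fI : injective f.
  move=> g h fgh.
  have /(can_inj PhiK) gh : Phi (alpha g^-1%g x) = Phi (alpha h^-1%g x).
    by rewrite !fE fgh.
  exact: invg_inj (free_orbit_inj halpha freex gh).
have fS l : exists g, f g = l.
  have [x' X1x' Phix'] : (Phi @` X1) (beta l^-1%g (Phi x)).
    rewrite -(hPhiX1 (I : setT l^-1%g)).
    by exists (Phi x) => //; exists x.
  have : schreier_dist alpha S x x' <> None.
    rewrite -hdist// Phix'; have := orbit_dist hbeta hT freey 1%g l.
    rewrite invg1 b1 => ->; apply/graph_dist_fin.
    exact: cayley_connected.
  move=> /(finite_dist_orbit halpha)[g x'E]; exists g^-1%g.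
  apply/invg_inj/(free_orbit_inj hbeta freey).
  by rewrite /= -fE invgK -x'E.
exists f; last by move=> g; rewrite /inv_conj -fE invgK.
split => //; have /choice[f' f'K] := fS.
by exists f' => // g; apply: fI; rewrite f'K.
Qed.

(** The cocycle takes countably many values almost everywhere, so one of its
    level sets [A] has positive measure.  The cocycle identity turns
    membership of [alpha g x] in [A] into the multiplicativity of [rho]. *)
Lemma constant_cocycle_piece :
  countable (Iso S) -> standard_borel R Y -> measurable X1 -> mu X1 = 1%E ->
  essentially_free mu alpha -> essentially_free nu beta ->
  exists (rho : Gamma -> Lambda) (A : set X),
    [/\ bijective rho /\ rho 1%g = 1%g,
        measurable A, (0 < mu A)%E,
        forall g x, A x -> Phi (alpha g x) = beta (rho g) (Phi x)
      & forall g x, A x -> A (alpha g x) <-> right_mult rho g].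
Proof.
move=> cI sY mX1 X11 falpha fbeta.
have cG := Iso_countable_group cI.
have [a1 aM aB amu] := halpha; have [b1 bM bB bmu] := hbeta.
(* Points with free orbits on both sides; W below is a conull invariant set of
   such points, needed for exact rather than almost sure identities. *)
pose P x := [/\ X1 x, forall g, alpha g x = x -> g = 1%g
  & forall l, beta l (Phi x) = Phi x -> l = 1%g].
have aeP : {ae mu, forall x, P x}.
  have aeX1 : {ae mu, forall x, X1 x}.
    exists (~` X1); split => //; first exact: measurableC.
    by rewrite probability_setC// X11 subee.
  have aefree : {ae mu, forall x, forall l, beta l (Phi x) = Phi x -> l = 1%g}.
    have [N [mN N0 freeN]] := fbeta.
    exists (Phi @^-1` N); split.
    - exact: measurable_fun_preimage hPhi.1 mN.
    - by rewrite -N0 -hPhimu.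
    - by move=> x nfree; exact: freeN.
  by apply: filterS3 aeX1 falpha aefree => x; split.
have [W [mW W1 WP Wa]] := ae_invariant_set halpha cG aeP.
pose J : set (Gamma -> Lambda) := [set f | cayley_isometry S T f].
have cJ : countable J := countable_isometries T cI.
pose piece f := W `&` \bigcap_(g in [set: Gamma])
  [set x | Phi (alpha g x) = beta (inv_conj f g) (Phi x)].
have mpiece f : measurable (piece f).
  apply: measurableI => //; apply: countable_bigcap_measurable => // g _.
  apply: (measurable_equalizer (u := Phi \o alpha g)
    (v := beta (inv_conj f g) \o Phi) sY).
    by apply: measurableT_comp; [exact: hPhi.1|have [] := aB g].
  by apply: measurableT_comp; [have [] := bB (inv_conj f g)|exact: hPhi.1].
(* Countably many null pieces cannot cover W. *)
have [f Jf piece0] : exists2 f, J f & (0 < mu (piece f))%E.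
  apply: contrapT => npos.
  have : mu.-negligible W.
    have : mu.-negligible (\bigcup_(f in J) piece f).
      apply: countable_bigcup_negligible => // f Jf.
      apply/negligibleP => //; apply/eqP; apply: contrapT => /negP pf.
      by apply: npos; exists f => //; rewrite lt0e pf measure_ge0.
    apply: negligibleS => x Wx; have [X1x freex freey] := WP _ Wx.
    have [f Jf fE] := orbit_isometry X1x freex freey.
    by exists f => //; split => // g _; exact: fE.
  move=> /(measure_negligible mW) W0.
  by move: W1; rewrite [mu W]W0 => /esym/eqP; rewrite onee_eq0.
have rhoE g x : piece f x -> Phi (alpha g x) = beta (inv_conj f g) (Phi x).
  by move=> [_ fx]; exact: fx.
have freey x g h : piece f x ->
    beta g (Phi x) = beta h (Phi x) -> g = h.
  by move=> [/WP[_ _ freex] _]; apply: (free_orbit_inj hbeta freex).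
have [x Ax] : piece f !=set0.
  by apply/set0P/eqP => f0; move: piece0; rewrite f0 measure0 ltxx.
exists (inv_conj f), (piece f); split => //.
  split; first by apply: inv_conj_bij; exact: Jf.1.
  by apply: (freey x) => //; rewrite -rhoE// a1 b1.
move=> g z Az; split=> [Agz h|rhog].
  by apply: (freey z) => //; rewrite -rhoE// aM rhoE// rhoE// bM.
split; first by apply: Wa; exact: Az.1.
move=> h _ /=.
by rewrite -aM (rhoE (h * g)%g)// rhog bM (rhoE g).
Qed.

Lemma measurably_isomorphic_restr (G0 : set Gamma) (X0 : set X)
    (rho : Gamma -> Lambda) :
  measurable X0 -> group_iso_on G0 (rho @` G0) rho ->
  (forall g, G0 g ->
    {ae mu, forall x, X0 x -> Phi (alpha g x) = beta (rho g) (Phi x)}) ->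
  measurably_isomorphic mu nu alpha G0 X0 beta (rho @` G0) (Phi @` X0).
Proof.
move=> mX0 rhoI rhoE; exists rho, Phi; split => //.
have PhiA A : measurable A -> measurable (Phi @` A).
  exact: measurable_image_bij.
have [Psi [PhiK PsiK _]] := hPhi.2.
exists X0, (Phi @` X0); split.
- by split => //; rewrite setDv measure0.
- by split; [exact: PhiA|by []|rewrite setDv measure0].
- by apply: inj_bij => x z _ _; exact: (can_inj PhiK).
- split; last by move=> A mA _; exact: PhiA.
  exact: measurable_funS hPhi.1.
- move=> B mB BX0; rewrite /normalized_restr.
  rewrite (measure_image_bij hPhi hPhimu)//; congr (_ * _)%E.
  rewrite (setIidl BX0) -hPhimu//; congr (mu _).
  apply/seteqP; split=> [x [[_ Bx] _]|x Bx] //=.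
  by have [z X0z /(can_inj PhiK) zx] := BX0 _ Bx; rewrite zx in X0z.
Qed.

End OrbitEquivalence.

(** * Isometric orbit equivalence with countable isometry groups *)

Theorem theorem1p3 (R : realType) (Gamma Lambda : groupType)
    (SGamma : set Gamma) (SLambda : set Lambda)
    (dX dY : measure_display)
    (X : measurableType dX) (mu : probability X R)
    (Y : measurableType dY) (nu : probability Y R)
    (alpha : Gamma -> X -> X) (beta : Lambda -> Y -> Y)
    (hSGamma : generating_system SGamma)
    (hSLambda : generating_system SLambda)
    (hCayley : cayley_isometric SGamma SLambda)
    (hX : standard_borel R X) (hY : standard_borel R Y)
    (halpha : pmp_action mu alpha) (hbeta : pmp_action nu beta)
    (falpha : essentially_free mu alpha) (fbeta : essentially_free nu beta)
    (hIOE : isometric_orbit_equivalent mu nu alpha beta SGamma SLambda) :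
  (countable (Iso SGamma) <-> countable (Iso SLambda)) /\
  (countable (Iso SGamma) ->
    (exists (Gamma0 : set Gamma) (Lambda0 : set Lambda),
      [/\ subgroup Gamma0 /\ finite_index Gamma0,
          subgroup Lambda0 /\ finite_index Lambda0,
          subgroups_isomorphic Gamma0 Lambda0
        & exists (X0 : set X) (Y0 : set Y),
          [/\ [/\ measurable X0, invariant_set alpha Gamma0 X0 & (0 < mu X0)%E],
              [/\ measurable Y0, invariant_set beta Lambda0 Y0 & (0 < nu Y0)%E]
            & measurably_isomorphic mu nu alpha Gamma0 X0 beta Lambda0 Y0]])
    /\
    ((forall H : set Gamma, subgroup H -> finite_index H ->
        ergodic mu alpha H) ->
      subgroups_isomorphic [set: Gamma] [set: Lambda] /\
      measurably_isomorphic mu nu alpha [set: Gamma] [set: X]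
        beta [set: Lambda] [set: Y])).
Proof.
split.
  split; first exact: countable_Iso_isometric.
  exact/countable_Iso_isometric/cayley_isometric_sym.
move=> cI.
have [Phi [X1 [hPhi hPhimu [mX1 aX1 X11] bX1 hdist]]] := hIOE.
have [rho [A [[rhoB rho1] mA A0 rhoE retA]]] :=
  constant_cocycle_piece hSGamma hSLambda halpha hbeta hPhi hPhimu
    aX1 bX1 hdist cI hY mX1 X11 falpha fbeta.
pose G0 := right_mult rho.
have sG0 : subgroup G0 := right_mult_subgroup rho1.
have fG0 : finite_index G0 := return_group_finite_index halpha sG0 mA A0 retA.
have aA : invariant_set alpha G0 A.
  by apply: (invariant_setP halpha) => // g x G0g Ax; apply/retA.
have rhoI := right_mult_group_iso_on rhoB.
have isoPhi := @measurably_isomorphic_restr _ _ _ _ _ _ _ _ _ alpha beta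
  _ hPhi hPhimu.
split.
  exists G0, (rho @` G0); split => //.
  - split; first exact: image_right_mult_subgroup.
    exact: image_right_mult_finite_index.
  - by exists rho.
  exists A, (Phi @` A); split.
  - by [].
  - split; first exact: measurable_image_bij.
      move=> _ [g G0g <-]; rewrite -[in RHS](aA g G0g) !image_comp.
      by apply: eq_imagel => x Ax /=; rewrite rhoE.
    by rewrite (measure_image_bij hPhi hPhimu).
  - apply: isoPhi => // g _.
    by apply: aeW => x Ax; exact: rhoE.
move=> erg.
have A1 : mu A = 1%E.
  have [A0'|//] := erg _ sG0 fG0 _ mA aA.
  by move: A0; rewrite A0' ltxx.
have nA0 : mu (~` A) = 0%E by rewrite probability_setC// A1 subee.
(* An element outside G0 would move the conull set A off itself. *)
have G0T : G0 = setT.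
  apply/seteqP; split => // g _.
  have [_ _ aB amu] := halpha.
  have mgA : measurable (alpha g @^-1` A).
    by apply: measurable_fun_preimage => //; have [] := aB g.
  apply: contrapT => nG0g.
  have gAA : alpha g @^-1` A `<=` ~` A.
    by move=> x Agx Ax; apply: nG0g; apply/(retA g x).
  have : (mu (alpha g @^-1` A) <= mu (~` A))%E.
    by rewrite le_measure ?inE//; exact: measurableC.
  have -> : mu (alpha g @^-1` A) = 1%E by rewrite -A1; exact: amu.
  by rewrite nA0 lee_fin ler10.
have rhoT : rho @` setT = setT.
  by apply/seteqP; split => // l _; have [rho' _ rhoK] := rhoB; exists (rho' l).
have PhiT : Phi @` setT = setT.
  apply/seteqP; split => // y _; have [Psi [_ PsiK _]] := hPhi.2.
  by exists (Psi y).
rewrite -/G0 G0T rhoT in rhoI.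
split; first by exists rho.
have := isoPhi setT setT rho measurableT; rewrite rhoT PhiT.
apply=> // g _; exists (~` A); split => //; first exact: measurableC.
by move=> x nE Ax; apply: nE => _; exact: rhoE.
Qed.
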